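(* Let $A\in\overline{\mathbb{R}}^{n\times n}$ with $\lambda(A)\geq 0$. Then the set $\mathscr{X}_{E}$ of vectors returned by the algorithm described in the context (applied to $A$) is the scaled basis of the supereigenvector space $\mathscr{X}'=\{\mathbf{x}\in\overline{\mathbb{R}}^{n}: A\otimes\mathbf{x}\geq\mathbf{x}\}$; that is, all elements of $\mathscr{X}_E$ are scaled and $\mathscr{X}_E$ is a (weakly) independent set of generators of $\mathscr{X}'$.
   Context: Max-plus notation. $\overline{\mathbb{R}}=\mathbb{R}\cup\{-\infty\}$ with $a\oplus b=\max(a,b)$ and $a\otimes b=a+b$, extended to matrices and vectors in the usual way, so $(A\otimes\mathbf{x})_i=\max_k(a_{ik}+x_k)$, and $\geq$ is entrywise. $N=\{1,\dots,n\}$. The vector all of whose entries are $-\infty$ is also denoted $-\infty$. $A_i$ is the $i$th row of $A=(a_{ij})$. $e^{i}\in\overline{\mathbb{R}}^n$ has $i$th entry $0$ and all other entries $-\infty$. $\mathscr{X}=\{\mathbf{x}\in\overline{\mathbb{R}}^n: A\otimes\mathbf{x}\geq\mathbf{x},\ \mathbf{x}\neq-\infty\}$, $\mathscr{X}'=\mathscr{X}\cup\{-\infty\}$, and $\mathscr{X}_i=\{\mathbf{x}\in\overline{\mathbb{R}}^n: A_i\otimes\mathbf{x}\geq x_i\}$ for $i\in N$. Bases. For $S\subseteq\overline{\mathbb{R}}^n$, a max-combination of $S$ is a vector $\sum^{\oplus}_{\mathbf{x}\in S}\alpha_{\mathbf{x}}\otimes\mathbf{x}$ with $\alpha_{\mathbf{x}}\in\overline{\mathbb{R}}$,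 only finitely many of them real; $\operatorname{span}(S)$ is the set of all max-combinations. $S$ is a set of generators of $T$ if $\operatorname{span}(S)=T$. $S$ is (weakly) independent if no $\mathbf{v}\in S$ is a max-combination of $S\setminus\{\mathbf{v}\}$. A basis of $T$ is an independent set of generators of $T$. For $\mathbf{v}\neq-\infty$, $\|\mathbf{v}\|=\max_i v_i$; $\mathbf{v}$ is scaled if $\|\mathbf{v}\|=0$, and $\|\mathbf{v}\|^{-1}\otimes\mathbf{v}$ denotes the vector obtained by subtracting $\|\mathbf{v}\|$ from every entry. A vector $\mathbf{v}\in\mathscr{X}'$, $\mathbf{v}\ne-\infty$, is called an extremal if for all $\mathbf{x},\mathbf{y}\in\mathscr{X}'$, $\mathbf{v}=\mathbf{x}\oplus\mathbf{y}$ implies $\mathbf{v}=\mathbf{x}$ or $\mathbf{v}=\mathbf{y}$. Digraph. $D_A$ is the weighted digraph on node set $N$ with an arc $(i,j)$ of weight $a_{ij}$ whenever $a_{ij}\neq-\infty$. The weight $\omega$ of a path or cycle is the sum of the weights of its arcs. $\lambda(A)$ is the maximum cycle mean of $A$, i.e. the maximum of (weight)/(length) over all cycles of $D_A$ ($-\infty$ if there are no cycles). An elementary cycle is a cycle $\sigma=(i_1,\dots,i_t,i_{t+1}=i_1)$, $t\ge 1$, with $i_1,\dots,i_t$ pairwise distinct (loops, $t=1$, are allowed); it is nonnegative if $\omega(\sigma)\geq 0$. Put $J_\sigma=\{i_1,\dots,i_t\}$. For $1\leq k\leq t$, $\sigma(i_k)=(j_1=i_k,j_2,\dots,j_t,j_{t+1}=j_1)$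 denotes the same cycle rewritten with starting node $i_k$. Maximum $J_\sigma$-path. A path $(l_1,\dots,l_m)$ in $D_A$ such that (1) $l_1,\dots,l_m$ are pairwise distinct; (2) $l_m$ is the unique node of the path belonging to $J_\sigma$; (3) there is no arc of $D_A$ from $l$ to $l_1$ for any $l\in N\setminus(J_\sigma\cup\{l_1,\dots,l_m\})$. The algorithm producing $\mathscr{X}_E$. Start with $\mathscr{X}_E=\emptyset$. For each nonnegative elementary cycle $\sigma=(i_1,\dots,i_t,i_{t+1}=i_1)$ in $D_A$ do the following. (Step 1) For each $k\in\{1,\dots,t\}$, write $\sigma(i_k)=(j_1=i_k,j_2,\dots,j_t,j_{t+1}=j_1)$, set $v^1=e^{j_1}$ and $p=1$; while $p\leq t-1$ and $v^p\notin\mathscr{X}_{j_p}$, set $v^{p+1}=e^{j_{p+1}}\oplus(A_{j_p}\otimes e^{j_{p+1}})\otimes v^p$ and increase $p$ by $1$. When this loop ends, set $v^{\sigma(i_k)}=v^p$. If $v^{\sigma(i_k)}$ is an extremal, add $\|v^{\sigma(i_k)}\|^{-1}\otimes v^{\sigma(i_k)}$ to $\mathscr{X}_E$. (Step 2) For each maximum $J_\sigma$-path $\pi=(l_1,\dots,l_m)$ in $D_A$, let $i_k=l_m$. If $v^{\sigma(i_k)}$ is an extremal, set $v^{l_m}=v^{\sigma(i_k)}$ and, for $q=1,2,\dots,m-1$ in this order: if $e^{l_{m-q}}\in\mathscr{X}_{l_{m-q}}$, stop processing $\pi$; otherwise set $v^{l_{m-q}}=v^{l_{m-q+1}}\oplus(A_{l_{m-q}}\otimes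 v^{l_{m-q+1}})\otimes e^{l_{m-q}}$; if $v^{l_{m-q}}$ is an extremal, add $\|v^{l_{m-q}}\|^{-1}\otimes v^{l_{m-q}}$ to $\mathscr{X}_E$ and continue with the next $q$; if it is not an extremal, stop processing $\pi$. The result, after all nonnegative elementary cycles have been processed, is $\mathscr{X}_E$. *)

(* Defs.v *)
From HB Require Import structures.
From mathcomp Require Import all_boot all_order all_algebra.
From mathcomp Require Import all_classical all_reals ereal.

Set Implicit Arguments.
Unset Strict Implicit.
Unset Printing Implicit Defensive.

Import Order.TTheory GRing.Theory Num.Theory.

Local Open Scope ring_scope.
Local Open Scope classical_set_scope.

(* The max-plus semiring over R: [None] is -oo and [Some a] is the real a.
   It is made into a commutative semiring whose ring operations are the max-plus
   ones, so in [maxplus R], and in matrices over it,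
     x + y  is the maximum,      x * y  is the sum (with -oo absorbing),
     0      is -oo,              1      is the real number 0,
   and *m, *:, \sum, delta_mx are the max-plus matrix product, scaling, ...
   The order is the usual one, written [(x <= y)%O]. *)
Definition maxplus (R : realType) : Type := option R.

HB.instance Definition _ (R : realType) := Choice.copy (maxplus R) (option R).

Section MaxPlus.
Variable R : realType.
Implicit Types x y z : maxplus R.

Definition mp_le x y : bool :=
  match x, y with
  | None, _ => true
  | Some _, None => false
  | Some a, Some b => a <= b
  end.

Fact mp_le_refl : reflexive mp_le.
Proof. by case=> /=. Qed.

Fact mp_le_anti : antisymmetric mp_le.
Proof. by case=> [a|] [b|] //= /le_anti ->. Qed.

Fact mp_le_trans : transitive mp_le.
Proof. by case=> [a|] [b|] [c|] //=; apply: le_trans. Qed.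

Fact mp_le_total : total mp_le.
Proof. by case=> [a|] [b|] //=; apply: le_total. Qed.

HB.instance Definition _ := Order.Le_isPOrder.Build
  Order.default_display (maxplus R) mp_le_refl mp_le_anti mp_le_trans.
HB.instance Definition _ := Order.POrder_isTotal.Build
  Order.default_display (maxplus R) mp_le_total.

Definition mp_add x y : maxplus R := Order.max x y.

Definition mp_mul x y : maxplus R :=
  match x, y with
  | Some a, Some b => Some (a + b)
  | _, _ => None
  end.

Definition mp_zero : maxplus R := None.
Definition mp_one : maxplus R := Some 0.

Fact mp_addA : associative mp_add. Proof. exact: maxA. Qed.
Fact mp_addC : commutative mp_add. Proof. exact: maxC. Qed.
Fact mp_add0 : left_id mp_zero mp_add.
Proof. by move=> x; apply/max_idPr. Qed.

Fact mp_mulA : associative mp_mul.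
Proof. by case=> [a|] [b|] [c|] //=; rewrite addrA. Qed.
Fact mp_mulC : commutative mp_mul.
Proof. by case=> [a|] [b|] //=; rewrite addrC. Qed.
Fact mp_mul1 : left_id mp_one mp_mul.
Proof. by case=> [a|] //=; rewrite add0r. Qed.
Fact mp_mul0 : left_zero mp_zero mp_mul.
Proof. by []. Qed.
Fact mp_mulDl : left_distributive mp_mul mp_add.
Proof.
move=> x y z; wlog xy : x y / (x <= y)%O.
  move=> h; case: (leP x y) => [|/ltW] /h // e.
  by rewrite mp_addC e mp_addC.
rewrite /mp_add (max_idPr xy); apply/esym/max_idPr.
by move: x y z xy => [a|] [b|] [c|] //; rewrite /Order.le /= lerD2r.
Qed.
Fact mp_one_neq0 : mp_one != mp_zero. Proof. by []. Qed.

HB.instance Definition _ :=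
  GRing.isNmodule.Build (maxplus R) mp_addA mp_addC mp_add0.
HB.instance Definition _ := GRing.Nmodule_isComNzSemiRing.Build (maxplus R)
  mp_mulA mp_mulC mp_mul1 mp_mulDl mp_mul0 mp_one_neq0.

(* Multiplicative inverse, i.e. the opposite of a real; the value at -oo is
   a dummy. *)
Definition mp_inv x : maxplus R := omap -%R x.

Section Vectors.
Variable n : nat.
Implicit Types (v : 'cV[maxplus R]_n) (S T : set 'cV[maxplus R]_n).

Definition unit_vec (i : 'I_n) : 'cV[maxplus R]_n := delta_mx i 0.

(* The \sum is a maximum, so this is max_i v_i. *)
Definition vnorm v : maxplus R := \sum_(i < n) v i 0.

Definition scaled v : Prop := vnorm v = 1.

Definition normalize v : 'cV[maxplus R]_n := mp_inv (vnorm v) *: v.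

Definition max_span S : set 'cV[maxplus R]_n :=
  [set v | exists alpha : 'cV[maxplus R]_n -> maxplus R,
     finite_set (S `&` [set x | alpha x != 0]) /\
     v = \sum_(x \in S) alpha x *: x].

Definition independent S : Prop := forall v, S v -> ~ max_span (S `\ v) v.

Definition generates S T : Prop := max_span S = T.

Definition is_basis S T : Prop := independent S /\ generates S T.

End Vectors.

Section Supereigenvectors.
Variables (n : nat) (A : 'M[maxplus R]_n).

(* A_i (x) x *)
Definition row_prod (i : 'I_n) (x : 'cV[maxplus R]_n) : maxplus R :=
  (row i A *m x) 0 0.

Definition supereig : set 'cV[maxplus R]_n :=
  [set x : 'cV[maxplus R]_n | forall i, (x i 0%R <= (A *m x) i 0%R)%O].

Definition supereig_row (i : 'I_n) : set 'cV[maxplus R]_n :=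
  [set x : 'cV[maxplus R]_n | (x i 0%R <= row_prod i x)%O].

Definition extremal (v : 'cV[maxplus R]_n) : Prop :=
  [/\ supereig v, v != 0 &
      forall x y : 'cV[maxplus R]_n,
        supereig x -> supereig y -> v = x + y -> v = x \/ v = y].

Definition arc : rel 'I_n := fun i j => A i j != 0.

(* Real value of a_ij, only meaningful on arcs. *)
Definition arc_weight (i j : 'I_n) : R := odflt 0 (A i j).

(* Weight of the path (i, p_1, ..., p_r). *)
Fixpoint path_weight (i : 'I_n) (p : seq 'I_n) : R :=
  if p is j :: p' then arc_weight i j + path_weight j p' else 0.

(* The cycle (i_1, ..., i_t, i_1) is represented by [:: i_1; ...; i_t]. *)
Definition is_cycle (s : seq 'I_n) : Prop := s != [::] /\ cycle arc s.

Definition cycle_weight (s : seq 'I_n) : R :=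
  if s is i :: p then path_weight i (rcons p i) else 0.

(* lambda(A). The supremum is a maximum when D_A has a cycle, since it is
   attained at an elementary cycle; it is -oo otherwise. *)
Definition max_cycle_mean : \bar R :=
  ereal_sup [set (cycle_weight s / (size s)%:R)%:E | s in is_cycle].

Definition nonneg_elem_cycle (s : seq 'I_n) : Prop :=
  [/\ is_cycle s, uniq s & 0 <= cycle_weight s].

(* J_sigma is the set of entries of s, and (l_1, ..., l_m) is l1 :: p. *)
Definition maximum_path (s : seq 'I_n) (l1 : 'I_n) (p : seq 'I_n) : Prop :=
  [/\ path arc l1 p,
      uniq (l1 :: p),
      forall l, l \in l1 :: p -> (l \in s) = (l == last l1 p) &
      forall l, l \notin s -> l \notin l1 :: p -> ~~ arc l l1].

(* The loop of step 1: v is v^p, j is j_p and rest is (j_(p+1), ..., j_t). *)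
Fixpoint step1_loop (v : 'cV[maxplus R]_n) (j : 'I_n) (rest : seq 'I_n) :
    'cV[maxplus R]_n :=
  if rest is j' :: rest' then
    if v \in supereig_row j then v
    else step1_loop (unit_vec j' + row_prod j (unit_vec j') *: v) j' rest'
  else v.

(* v^(sigma(i)) for a node i of an elementary cycle s; as the entries of s are
   distinct, the index k with i_k = i is determined by i. *)
Definition cycle_vec (s : seq 'I_n) (i : 'I_n) : 'cV[maxplus R]_n :=
  step1_loop (unit_vec i) i (behead (rot (index i s) s)).

(* The loop of step 2: v is v^(l_(m-q+1)) and rest is (l_(m-q), ..., l_1); the
   result is the sequence of vectors added to X_E. *)
Fixpoint step2_loop (v : 'cV[maxplus R]_n) (rest : seq 'I_n) :
    seq 'cV[maxplus R]_n :=
  if rest is l :: rest' then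
    if unit_vec l \in supereig_row l then [::]
    else let v' := v + row_prod l v *: unit_vec l in
      if `[< extremal v' >] then normalize v' :: step2_loop v' rest' else [::]
  else [::].

Definition step1 (s : seq 'I_n) : set 'cV[maxplus R]_n :=
  [set normalize (cycle_vec s i) | i in
     [set i | i \in s /\ extremal (cycle_vec s i)]].

Definition step2 (s : seq 'I_n) : set 'cV[maxplus R]_n :=
  [set w | exists l1 p,
     [/\ maximum_path s l1 p,
         extremal (cycle_vec s (last l1 p)) &
         w \in step2_loop (cycle_vec s (last l1 p))
                          (behead (rev (l1 :: p)))]].

Definition algorithm_output : set 'cV[maxplus R]_n :=
  \bigcup_(s in nonneg_elem_cycle) (step1 s `|` step2 s).

End Supereigenvectors.

End MaxPlus.

(* Main.v *)
Require Import Defs.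
From mathcomp Require Import all_boot all_order all_algebra.
From mathcomp Require Import all_classical all_reals ereal.

(* Entrywise order is the key: [v] is an extremal iff, for some [i], it is
   minimal among the supereigenvectors with the same i-th entry.  From a node
   [i] in the support of a supereigenvector [x], arcs with
   [x_j <= a_jk x_k] can be followed until a node repeats.  The vector which is
   tight along this path, with i-th entry [x_i], is a supereigenvector below
   [x]; there are finitely many paths, so a minimal one lies below every [x],
   and extremals generate.
   An extremal [v] is therefore tight along a path consisting of a tail followed
   by a nonnegative cycle.  If, at a node [j] of the path other than the last
   one, [v] restricted to the nodes up to [j] satisfied row [j], this restriction
   would be a smaller supereigenvector: hence the algorithm run on this cycle and
   this tail never stops early.  If row [j] applied to the part of [v] after [j]
   exceeded [v_j], that part could be scaled down: hence step 2 rebuilds exactly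
   the entries of [v].  Finally all suffixes of [v] that contain the cycle are
   again minimal, so they pass the extremality tests. *)

Set Implicit Arguments.
Unset Strict Implicit.
Unset Printing Implicit Defensive.

Import Order.TTheory GRing.Theory Num.Theory.

Local Open Scope ring_scope.
Local Open Scope classical_set_scope.

(** * Order and arithmetic of max-plus scalars *)

Section Scalars.
Variable R : realType.
Implicit Types x y z : maxplus R.

Lemma mp_addE x y : x + y = Order.max x y.
Proof. by []. Qed.

Lemma mp_ge0 x : ((0 : maxplus R) <= x)%O.
Proof. by []. Qed.

Lemma mp_le0 x : (x <= (0 : maxplus R))%O = (x == 0).
Proof. by rewrite eq_le mp_ge0 andbT. Qed.

Lemma mp_neq0_le x y : x != 0 -> (x <= y)%O -> y != 0.
Proof. by move=> x0 xy; apply: contraNneq x0 => y0; rewrite -mp_le0 -y0. Qed.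

Lemma mp_mul_neq0 x y : (x * y != 0) = (x != 0) && (y != 0).
Proof. by case: x => [a|]; case: y => [b|]. Qed.

Lemma mp_inv_neq0 x : (mp_inv x != 0) = (x != 0).
Proof. by case: x. Qed.

Lemma mp_mulV x : x != 0 -> x * mp_inv x = 1.
Proof. by case: x => [a|//] _; congr Some; rewrite subrr. Qed.

Lemma mp_mulKV x y : x != 0 -> x * (mp_inv x * y) = y.
Proof. by move=> x0; rewrite mulrA mp_mulV ?mul1r. Qed.

Lemma mp_mulVK x y : x != 0 -> mp_inv x * (x * y) = y.
Proof. by move=> x0; rewrite mulrCA mp_mulKV. Qed.

Lemma mp_invM x y : mp_inv (x * y) = mp_inv x * mp_inv y.
Proof. by case: x => [a|]; case: y => [b|] //; congr Some; rewrite opprD. Qed.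

Lemma mp_leM2l z x y : (x <= y)%O -> (z * x <= z * y)%O.
Proof.
move: x y z => [a|] [b|] [c|] //=; rewrite /Order.le /= => h.
by rewrite lerD2l.
Qed.

Lemma mp_leM x1 y1 x2 y2 :
  (x1 <= y1)%O -> (x2 <= y2)%O -> (x1 * x2 <= y1 * y2)%O.
Proof.
move=> h1 h2; apply: le_trans (mp_leM2l _ h2) _.
by rewrite ![_ * y2]mulrC; apply: mp_leM2l.
Qed.

Lemma mp_lepM2l z x y : z != 0 -> (z * x <= z * y)%O = (x <= y)%O.
Proof.
move=> z0; apply/idP/idP; last exact: mp_leM2l.
by move=> /(mp_leM2l (mp_inv z)); rewrite !mp_mulVK.
Qed.

Lemma mp_ler_add x y : (x <= x + y)%O.
Proof. by rewrite mp_addE le_max lexx. Qed.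

Lemma mp_ler_addr x y : (y <= x + y)%O.
Proof. by rewrite mp_addE le_max lexx orbT. Qed.

Lemma mp_add_le x y z : (x + y <= z)%O = (x <= z)%O && (y <= z)%O.
Proof. by rewrite mp_addE ge_max. Qed.

Lemma mp_le_sum (I : eqType) (r : seq I) (P : pred I) (F : I -> maxplus R) i :
  i \in r -> P i -> (F i <= \sum_(j <- r | P j) F j)%O.
Proof. by move=> ir Pi; rewrite (big_rem i) //= Pi mp_ler_add. Qed.

Lemma mp_sum_le (I : Type) (r : seq I) (P : pred I) (F : I -> maxplus R) x :
  (forall i, P i -> (F i <= x)%O) -> (\sum_(j <- r | P j) F j <= x)%O.
Proof.
move=> h; elim/big_ind: _ => //= a b ha hb; by rewrite mp_add_le ha.
Qed.

(** A finite maximum is attained; [x != 0] excludes the empty sum, which is $-\infty$. *)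
Lemma mp_le_sum_ex (I : Type) (r : seq I) (F : I -> maxplus R) x :
  x != 0 -> (x <= \sum_(j <- r) F j)%O -> exists j, (x <= F j)%O.
Proof.
move=> x0; elim: r => [|j r IH].
  by rewrite big_nil mp_le0 (negbTE x0).
by rewrite big_cons mp_addE le_max => /orP[?|/IH //]; exists j.
Qed.

End Scalars.

(** * Supereigenvectors under the entrywise order *)

Section Cone.
Variables (R : realType) (n : nat) (A : 'M[maxplus R]_n).
Implicit Types (u v w x y : 'cV[maxplus R]_n) (i j k : 'I_n).
Implicit Types (p q s l : seq 'I_n).

Definition vle v w := forall j, (v j 0 <= w j 0)%O.

Lemma vle_anti v w : vle v w -> vle w v -> v = w.
Proof.
move=> h1 h2; apply/matrixP => j k; rewrite ord1.
by apply: le_anti; rewrite h1 h2.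
Qed.

Lemma vle_trans u v w : vle u v -> vle v w -> vle u w.
Proof. by move=> h1 h2 j; apply: le_trans (h1 j) (h2 j). Qed.

Lemma row_prodE j x : row_prod A j x = \sum_k A j k * x k 0.
Proof. by rewrite /row_prod mxE; apply: eq_bigr => k _; rewrite mxE. Qed.

Lemma row_prod_mulmx j x : (A *m x) j 0 = row_prod A j x.
Proof. by rewrite mxE row_prodE. Qed.

Lemma supereigP x :
  supereig A x <-> forall j, (x j 0 <= row_prod A j x)%O.
Proof.
by split=> h j; move: (h j); rewrite row_prod_mulmx.
Qed.

Lemma le_row_prod j k x : (A j k * x k 0 <= row_prod A j x)%O.
Proof.
by rewrite row_prodE; exact: (mp_le_sum (fun k => A j k * x k 0) (mem_index_enum _)).
Qed.

Lemma row_prod_mono j x y : vle x y -> (row_prod A j x <= row_prod A j y)%O.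
Proof.
move=> xy; rewrite row_prodE; apply: mp_sum_le => k _.
by apply: le_trans (le_row_prod _ _ _); apply: mp_leM2l.
Qed.

Lemma row_prodZ j a x : row_prod A j (a *: x) = a * row_prod A j x.
Proof.
rewrite !row_prodE mulr_sumr; apply: eq_bigr => k _.
by rewrite mxE mulrCA.
Qed.

Lemma unit_vecE i j : unit_vec R i j 0 = (j == i)%:R.
Proof. by rewrite mxE eqxx andbT. Qed.

Lemma row_prod_unit_vec i j : row_prod A i (unit_vec R j) = A i j.
Proof.
rewrite row_prodE (bigD1 j) //= unit_vecE eqxx mulr1 big1 ?addr0 // => k kj.
by rewrite unit_vecE (negbTE kj) mulr0.
Qed.

Lemma supereig0 : supereig A 0.
Proof. by move=> j; rewrite mxE mp_ge0. Qed.

Lemma supereigD x y : supereig A x -> supereig A y -> supereig A (x + y).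
Proof.
move=> /supereigP hx /supereigP hy; apply/supereigP => j.
rewrite mxE mp_add_le; apply/andP; split.
  apply: le_trans (hx j) _; apply: row_prod_mono => k.
  by rewrite mxE mp_ler_add.
apply: le_trans (hy j) _; apply: row_prod_mono => k.
by rewrite mxE mp_ler_addr.
Qed.

Lemma supereigZ a x : supereig A x -> supereig A (a *: x).
Proof.
move=> /supereigP hx; apply/supereigP => j.
by rewrite row_prodZ mxE; apply: mp_leM2l.
Qed.

Lemma supereig_sum (I : Type) (r : seq I) (P : pred I) F :
  (forall t, P t -> supereig A (F t)) -> supereig A (\sum_(t <- r | P t) F t).
Proof.
by move=> h; apply: big_ind => //; [exact: supereig0 | exact: supereigD].
Qed.

(** * Extremals as minimal vectors with a prescribed entry *)

Definition minimal_at i v :=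
  [/\ supereig A v, v i 0 != 0 &
      forall x, supereig A x -> vle x v -> x i 0 = v i 0 -> x = v].

(** In [v = x + y] one summand attains the [i]-th entry; it lies below [v], so minimality makes it
    equal to [v]. *)
Lemma minimal_at_extremal i v : minimal_at i v -> extremal A v.
Proof.
move=> [vX vi vmin]; split => //.
  by apply: contraNneq vi => ->; rewrite mxE.
move=> x y xX yX vxy.
have xv : vle x v by move=> j; rewrite vxy mxE mp_ler_add.
have yv : vle y v by move=> j; rewrite vxy mxE mp_ler_addr.
have : v i 0 = x i 0 + y i 0 by rewrite vxy mxE.
rewrite mp_addE; case: leP => _ e; [right|left]; symmetry; exact: vmin.
Qed.

Lemma extremal_sum (I : eqType) (r : seq I) F v : extremal A v ->
  (forall t, t \in r -> supereig A (F t)) -> v = \sum_(t <- r) F t ->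
  exists2 t, t \in r & v = F t.
Proof.
move=> [vX v0 vext]; elim: r => [|t r IH] FX.
  by rewrite big_nil => v00; rewrite v00 eqxx in v0.
rewrite big_cons => /vext[||->|vs].
- by apply: FX; rewrite mem_head.
- rewrite big_seq; apply: supereig_sum => t' t'r.
  by apply: FX; rewrite inE t'r orbT.
- by exists t; rewrite ?mem_head.
- have [t' t'r ->] : exists2 t', t' \in r & v = F t'.
    by apply: IH => // t' t'r; apply: FX; rewrite inE t'r orbT.
  by exists t'; rewrite // inE t'r orbT.
Qed.

(** If minimality failed at every [i], some supereigenvector [g i] below [v], with the same [i]-th
    entry, would differ from [v]. These add up to [v], so extremality would give [v = g i] for some
    [i]. *)
Lemma extremal_minimal_at v : extremal A v -> exists i, minimal_at i v.
Proof.
move=> vext; have [vX v0 _] := vext; apply: contrapT => nmin.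
have hx i : exists x, [/\ supereig A x, vle x v, x i 0 = v i 0 & x <> v].
  (* At an entry $-\infty$ the zero vector is such a witness. *)
  have [vi0|vi0] := eqVneq (v i 0) 0.
    exists 0; split => //; first exact: supereig0.
    - by move=> j; rewrite mxE mp_ge0.
    - by rewrite vi0 mxE.
    - by move=> v00; rewrite -v00 eqxx in v0.
  apply: contrapT => nx; apply: nmin; exists i; split=> // x xX xv xi.
  by apply: contrapT => xnv; apply: nx; exists x.
have [g gP] := choice hx.
have [||i _ vg] := @extremal_sum _ (index_enum 'I_n) g v vext.
- by move=> i _; case: (gP i).
- apply: vle_anti => j; rewrite summxE.
    case: (gP j) => _ _ <- _.
    by exact: (mp_le_sum (fun i => g i j 0) (mem_index_enum _)).
  by apply: mp_sum_le => i _; case: (gP i).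
- by case: (gP i) => _ _ _; apply.
Qed.

Lemma extremalZ a v : a != 0 -> extremal A v -> extremal A (a *: v).
Proof.
move=> a0 [vX v0 vext].
have aK x : mp_inv a *: (a *: x) = x.
  by rewrite scalerA mulrC mp_mulV ?scale1r.
split; first exact: supereigZ.
  by apply: contraNneq v0 => av0; rewrite -(aK v) av0 scaler0.
move=> x y xX yX /(congr1 (fun z => mp_inv a *: z)); rewrite aK scalerDr.
have Ka x' : a *: (mp_inv a *: x') = x' by rewrite scalerA mp_mulV ?scale1r.
by case/vext=> [||->|->]; rewrite ?Ka; auto; apply: supereigZ.
Qed.

(** * Admissible paths and the vectors tight along them *)

Definition adm x : rel 'I_n :=
  fun j k => (x j 0 != 0) && (x j 0 <= A j k * x k 0)%O.

(** A real [x j 0] bounded by [A j k * x k 0] forces both factors to be real, so admissible steps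
    follow arcs and stay in the support of [x]. *)
Lemma adm_arc x j k : adm x j k -> Defs.arc A j k.
Proof.
case/andP=> xj /(mp_neq0_le xj); by rewrite mp_mul_neq0 => /andP[].
Qed.

Lemma adm_neq0 x j k : adm x j k -> x k 0 != 0.
Proof.
case/andP=> xj /(mp_neq0_le xj); by rewrite mp_mul_neq0 => /andP[].
Qed.

Lemma supereig_adm x j : supereig A x -> x j 0 != 0 -> exists k, adm x j k.
Proof.
move=> /supereigP /(_ j) + xj; rewrite row_prodE => /(mp_le_sum_ex xj)[k h].
by exists k; rewrite /adm xj.
Qed.

Lemma adm_path_closing x i : supereig A x -> x i 0 != 0 ->
  exists l, [/\ path (adm x) i l, uniq (i :: l) &
    exists2 z, z \in i :: l & adm x (last i l) z].
Proof.
move=> xX xi.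
(* Extend the path until a node repeats; [m] bounds the number of extensions left, as at most [n]
   nodes are distinct. *)
suff H m l : (n <= size l + m)%N -> path (adm x) i l -> uniq (i :: l) ->
  exists l, [/\ path (adm x) i l, uniq (i :: l) &
    exists2 z, z \in i :: l & adm x (last i l) z].
  by apply: (H n [::]).
elim: m l => [|m IH] l.
  rewrite addn0 => + _ /card_uniqP ci.
  have := max_card (mem (i :: l)); rewrite ci card_ord /= => h1 h2.
  by move: (leq_trans h1 h2); rewrite ltnn.
move=> hs pl ul.
have xl : x (last i l) 0 != 0.
  case/lastP: l pl {ul hs} => [//|l y].
  by rewrite last_rcons rcons_path => /andP[_ /adm_neq0].
have [z az] := supereig_adm xX xl.
have [zl|zl] := boolP (z \in i :: l); first by exists l; split => //; exists z.
apply: (IH (rcons l z)).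
- by rewrite size_rcons addSnnS.
- by rewrite rcons_path pl.
- by rewrite -rcons_cons rcons_uniq zl.
Qed.

Lemma path_succ (e : rel 'I_n) i l j : path e i l -> j \in belast i l ->
  exists2 k, k \in l & e j k.
Proof.
elim: l i => [//|k l IH] i /= /andP[eik pl]; rewrite inE.
case/predU1P => [->|/(IH _ pl)[k' k'l ejk']].
  by exists k; rewrite ?mem_head.
by exists k'; rewrite // inE k'l orbT.
Qed.

(** Along a duplicate-free path of arcs, starting from the value [c] at [i], each entry is chosen so
    that $a_{jk}+t_k=t_j$ holds for consecutive nodes; off the path the entries are $-\infty$. *)
Fixpoint tight_vec (c : maxplus R) i l : 'cV[maxplus R]_n :=
  c *: unit_vec R i +
  (if l is k :: l' then tight_vec (c * mp_inv (A i k)) k l' else 0).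

Lemma tight_vec_head c i l : (c <= tight_vec c i l i 0)%O.
Proof.
case: l => [|k l] /=; rewrite mxE; apply: le_trans (mp_ler_add _ _);
  by rewrite mxE unit_vecE eqxx mulr1.
Qed.

Lemma tight_vec_out c i l j : j \notin i :: l -> tight_vec c i l j 0 = 0.
Proof.
elim: l i c => [|k l IH] i c /=.
  rewrite inE => ji.
  by rewrite !mxE eqxx andbT (negbTE ji) mulr0 addr0.
rewrite inE negb_or => /andP[ji jl].
by rewrite mxE mxE unit_vecE (negbTE ji) mulr0 add0r IH.
Qed.

(** Each step is an equality for the tight vector but only an inequality for [x], so relative to the
    head the tight vector is lower. The product form with free [c] suits the induction and avoids
    inverting entries. *)
Lemma tight_vec_ratio x c i l j : path (adm x) i l ->
  (tight_vec c i l j 0 * x i 0 <= c * x j 0)%O.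
Proof.
elim: l i c => [|k l IH] i c /=.
  move=> _; rewrite addr0 mxE unit_vecE; case: eqP => [->|_].
    by rewrite mulr1.
  by rewrite mulr0 mul0r mp_ge0.
case/andP=> aik pl; rewrite mxE mulrDl mp_add_le; apply/andP; split.
  rewrite mxE unit_vecE; case: eqP => [->|_]; first by rewrite mulr1.
  by rewrite mulr0 mul0r mp_ge0.
have Aik := adm_arc aik; case/andP: aik => _ aik.
apply: le_trans (mp_leM2l _ aik) _; rewrite mulrCA.
apply: le_trans (mp_leM2l _ (IH _ _ pl)) _.
by rewrite mulrA [A i k * (c * _)]mulrCA mp_mulV // mulr1.
Qed.

Lemma tight_vec_le x i l : path (adm x) i l -> x i 0 != 0 ->
  vle (tight_vec (x i 0) i l) x.
Proof.
move=> pl xi j; rewrite -(mp_lepM2l _ _ xi) mulrC.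
exact: tight_vec_ratio.
Qed.

Lemma tight_vec_headE x i l : path (adm x) i l -> x i 0 != 0 ->
  tight_vec (x i 0) i l i 0 = x i 0.
Proof.
move=> pl xi; apply: le_anti; rewrite tight_vec_head andbT.
exact: tight_vec_le.
Qed.

(** The same comparison started at [z]: heads are dropped until [z] is reached, and [uniq] keeps a
    dropped head from contributing to later entries. *)
Lemma tight_vec_last_ratio x c i l z : path (adm x) i l -> z \in i :: l ->
  uniq (i :: l) ->
  (tight_vec c i l (last i l) 0 * x z 0 <= tight_vec c i l z 0 * x (last i l) 0)%O.
Proof.
elim: l i c => [|k l IH] i c pl.
  by rewrite inE => /eqP ->.
rewrite inE => /predU1P[-> _|zl /= /andP[il ul]].
  apply: le_trans (tight_vec_ratio _ _ pl) _.
  rewrite ![_ * x (last _ _) 0]mulrC; apply: mp_leM2l; exact: tight_vec_head.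
have off j : j \in k :: l ->
    tight_vec c i (k :: l) j 0 = tight_vec (c * mp_inv (A i k)) k l j 0.
  move=> jl; rewrite mxE mxE unit_vecE.
  by case: eqP => [ji|_]; rewrite ?mulr0 ?add0r // -ji jl in il *.
move: (off _ (mem_last k l)) (off _ zl) => /= -> ->.
by case/andP: pl => _ pl; apply: IH.
Qed.

(** A node with a successor has its row satisfied by that successor; nodes off the path have entry
    $-\infty$. *)
Lemma tight_vec_succ c i l j : path (Defs.arc A) i l ->
  (tight_vec c i l j 0 <= row_prod A j (tight_vec c i l))%O \/ j = last i l.
Proof.
elim: l i c => [|k l IH] i c /=.
  move=> _; case: (eqVneq j i) => [->|ji]; [by right|left].
  by rewrite addr0 mxE unit_vecE (negbTE ji) mulr0 mp_ge0.
case/andP=> aik /(IH _ (c * mp_inv (A i k))) [h|]; [left|by right].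
set t := tight_vec _ k l in h *.
have tt' : vle t (c *: unit_vec R i + t).
  by move=> z; rewrite [X in (_ <= X)%O]mxE mp_ler_addr.
rewrite [X in (X <= _)%O]mxE mp_add_le (le_trans h (row_prod_mono _ tt')) andbT.
rewrite mxE unit_vecE; case: eqP => [->|_]; last by rewrite mulr0 mp_ge0.
rewrite mulr1; apply: le_trans (le_row_prod _ k _).
rewrite -[X in (X <= _)%O](mp_mulKV c aik); apply: mp_leM2l.
apply: le_trans (tt' k); rewrite mulrC; exact: tight_vec_head.
Qed.

Lemma tight_vec_supereig x i l z : path (adm x) i l -> uniq (i :: l) ->
  z \in i :: l -> adm x (last i l) z -> supereig A (tight_vec (x i 0) i l).
Proof.
move=> pl ul zl /[dup] azl /andP[xl alz]; apply/supereigP => j.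
have [|//|->] := @tight_vec_succ (x i 0) i l j.
  by apply: sub_path pl => a b; apply: adm_arc.
(* The row of the last node is satisfied through the closing arc to [z]: multiply by the real entry
   of [x] there and compare ratios. *)
apply: le_trans (le_row_prod _ z _).
rewrite -(mp_lepM2l _ _ xl); set t := tight_vec _ _ _.
rewrite mulrC; apply: le_trans (mp_leM2l _ alz) _.
rewrite mulrCA [_ * (A _ _ * _)]mulrCA; apply: mp_leM2l.
by rewrite [x (last i l) 0 * _]mulrC; apply: tight_vec_last_ratio.
Qed.

(** * Existence of minimal vectors *)

Lemma fin_minimal (T : finType) (P : pred T) (e : rel T) t0 :
  transitive e -> reflexive e -> P t0 ->
  exists2 t, P t & forall t', P t' -> e t' t -> e t t'.
Proof.
move=> etr er Pt0.
(* Minimize the number of elements below [t]; this works for a preorder, and different paths may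
   indeed give the same vector. *)
case: (arg_minnP (fun t => #|[pred t' | P t' && e t' t]|) Pt0) => t Pt tmin.
exists t => // t' Pt' ett'; apply: contraT => nett'.
suff : (#|[pred u | P u && e u t']| < #|[pred u | P u && e u t]|)%N.
  by rewrite ltnNge tmin.
apply: proper_card; apply/fintype.properP; split.
  by apply/fintype.subsetP => u; rewrite !inE => /andP[-> /= h]; apply: etr ett'.
by exists t; rewrite !inE Pt ?er //= negb_and nett' orbT.
Qed.

Lemma minimal_at_below v i : supereig A v -> v i 0 != 0 ->
  exists u, [/\ minimal_at i u, vle u v & u i 0 = v i 0].
Proof.
move=> vX vi.
(* Sequences of length at most [n] form a finite type containing all duplicate-free paths. *)
pose c := v i 0; pose T := {bseq n of 'I_n}.
pose P := fun l : T => `[< [/\ supereig A (tight_vec c i l),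
  vle (tight_vec c i l) v & tight_vec c i l i 0 = c] >].
pose e := fun l l' : T => `[< vle (tight_vec c i l) (tight_vec c i l') >].
have key x : supereig A x -> x i 0 = c ->
    exists l : T, [/\ supereig A (tight_vec c i l),
      vle (tight_vec c i l) x & tight_vec c i l i 0 = c].
  move=> xX xi; have xi0 : x i 0 != 0 by rewrite xi.
  have [l [pl ul [z zl lz]]] := adm_path_closing xX xi0.
  have sl : (size l <= n)%N.
    move: ul => /andP[_ /card_uniqP <-]; rewrite -[X in (_ <= X)%N](card_ord n).
    exact: max_card.
  exists (Bseq sl); rewrite /= -xi; split.
  - exact: tight_vec_supereig lz.
  - exact: tight_vec_le.
  - exact: tight_vec_headE.
have [l0 l0P] := key v vX erefl.
have [||l /asboolP[lX lv li] lmin] := @fin_minimal T P e l0 _ _ (asboolT l0P).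
- by move=> a b d /asboolP h /asboolP h'; apply/asboolP; apply: vle_trans h'.
- by move=> a; apply/asboolP => j.
exists (tight_vec c i l); split => //; split => //; first by rewrite li.
move=> x xX xu xi; rewrite li in xi.
(* Any competitor [x] lies above a tight vector, so minimality among tight vectors suffices. *)
have [l' [l'X l'x l'i]] := key x xX xi.
apply: vle_anti => //; apply: (vle_trans _ l'x).
suff /lmin h : P l'.
  have /h : e l' l by apply/asboolP; exact: vle_trans l'x xu.
  by move/asboolP.
by apply/asboolP; split => //; apply: vle_trans l'x (vle_trans xu lv).
Qed.

(** * Restriction to a set of nodes, and grafting *)

Definition restrict v s : 'cV[maxplus R]_n :=
  \col_j (if j \in s then v j 0 else 0).

Lemma restrictE v s j : restrict v s j 0 = if j \in s then v j 0 else 0.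
Proof. by rewrite mxE. Qed.

Lemma restrict_le v s : vle (restrict v s) v.
Proof. by move=> j; rewrite restrictE; case: ifP. Qed.

Lemma restrict_subset v s s' : {subset s <= s'} ->
  vle (restrict v s) (restrict v s').
Proof.
move=> ss' j; rewrite !restrictE; case: ifP => [/ss' -> //|_].
exact: mp_ge0.
Qed.

Lemma restrict_cons v i s :
  restrict v (i :: s) = restrict v s + v i 0 *: unit_vec R i.
Proof.
apply/matrixP => j k; rewrite ord1 [RHS]mxE [X in _ + X]mxE unit_vecE !restrictE inE.
case: eqP => [->|_]; last by rewrite mulr0 addr0.
by rewrite mulr1; case: ifP; rewrite ?add0r // mp_addE maxxx.
Qed.

Lemma restrict_rcons v i s :
  restrict v (rcons s i) = restrict v s + v i 0 *: unit_vec R i.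
Proof.
by rewrite -restrict_cons; apply/matrixP => j k; rewrite !mxE mem_rcons.
Qed.

(** What follows a prefix of the path may be replaced by any [w]: prefix nodes before the last are
    supported by their successors, so only the last node's row and the rows for [w] need
    checking. *)
Lemma graft_supereig v w i p : path (adm v) i p ->
  (v (last i p) 0%R <= row_prod A (last i p) (restrict v (i :: p) + w))%O ->
  (forall j, (w j 0%R <= row_prod A j (restrict v (i :: p) + w))%O) ->
  supereig A (restrict v (i :: p) + w).
Proof.
move=> pp hl hw; apply/supereigP => j.
rewrite mxE mp_add_le hw andbT restrictE.
case: ifP => [|_]; last exact: mp_ge0.
rewrite {1}lastI mem_rcons inE => /predU1P[-> //|/(path_succ pp)[k kp]].
case/andP=> _ vjk; apply: le_trans vjk (le_trans (mp_leM2l _ _) (le_row_prod _ k _)).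
by rewrite mxE restrictE inE kp orbT mp_ler_add.
Qed.

Lemma cat_belast_last (T : Type) (x : T) (s t : seq T) :
  x :: s ++ t = belast x s ++ last x s :: t.
Proof. by rewrite -cat_rcons -lastI. Qed.

(** * Structure of a minimal vector along its closed path *)

Section MinimalPath.
Variables (v : 'cV[maxplus R]_n) (i z : 'I_n) (l : seq 'I_n).
Hypotheses (vmin : minimal_at i v) (lpath : path (adm v) i l).
Hypotheses (luniq : uniq (i :: l)) (zl : z \in i :: l).
Hypothesis (lz : adm v (last i l) z).

(** The tight vector along the path is a supereigenvector below [v] with the same [i]-th entry,
    hence equals [v]. *)
Lemma minimal_support j : v j 0 != 0 -> j \in i :: l.
Proof.
have [_ vi vm] := vmin.
have <- : tight_vec (v i 0) i l = v.
  apply: vm; [exact: tight_vec_supereig lz|exact: tight_vec_le|].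
  exact: tight_vec_headE.
by apply: contraNT => /tight_vec_out ->.
Qed.

Lemma restrict_all : restrict v (i :: l) = v.
Proof.
apply/matrixP => j k; rewrite ord1 restrictE.
by case: ifPn => // /(contraNeq (@minimal_support j)) ->.
Qed.

Let split_path s (x y : 'I_n) q : i :: l = s ++ x :: y :: q ->
  exists2 p, i :: p = rcons s x &
    [/\ x = last i p, l = p ++ y :: q, path (adm v) i p, adm v x y & path (adm v) y q].
Proof.
move=> e.
have [p [ep xp lp]] : exists p, [/\ i :: p = rcons s x, x = last i p & l = p ++ y :: q].
  case: s e => [|j s] [-> ->]; first by exists [::].
  by exists (rcons s x); rewrite last_rcons cat_rcons.
exists p => //; move: lpath; rewrite lp cat_path /= -xp => /and3P[]; by [].
Qed.

(* Otherwise the prefix alone would be a smaller supereigenvector. *)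
Lemma minimal_prefix_lt s (x y : 'I_n) q : i :: l = s ++ x :: y :: q ->
  (row_prod A x (restrict v (rcons s x)) < v x 0%R)%O.
Proof.
move=> e; have [p <- [xp lp pp xy yq]] := split_path e.
rewrite ltNge; apply/negP; rewrite xp => h.
have [_ vi vm] := vmin.
have uv : restrict v (i :: p) + 0 = v.
  apply: vm.
  - by apply: graft_supereig => // [|j]; rewrite ?addr0 // mxE mp_ge0.
  - by rewrite addr0; apply: restrict_le.
  - by rewrite addr0 restrictE mem_head.
(* By [uniq], [y] lies outside the prefix, yet its entry in [v] is real. *)
have := adm_neq0 xy; rewrite -uv addr0 restrictE ifF ?eqxx //.
move: luniq; rewrite lp -cat_cons cat_uniq => /and3P[_ + _].
by rewrite /= negb_or => /andP[/negbTE].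
Qed.

(* Otherwise the part of [v] after [x] could be scaled down. *)
Lemma minimal_suffix_eq s (x y : 'I_n) q : i :: l = s ++ x :: y :: q ->
  row_prod A x (restrict v (y :: q)) = v x 0.
Proof.
move=> e; have [p _ [xp lp pp xy yq]] := split_path e.
have [_ vi vm] := vmin.
set w := restrict v (y :: q); set r := row_prod A x w.
have [vx0 vxy] := andP xy.
have vxr : (v x 0%R <= r)%O.
  apply: le_trans vxy (le_trans _ (le_row_prod _ y _)).
  by rewrite /w restrictE mem_head.
have r0 : r != 0 := mp_neq0_le vx0 vxr.
(* The lowering that makes row [x] applied to the suffix exactly [v x 0]; as a real number it is at
   most 0. *)
pose a := v x 0 * mp_inv r.
have ar : a * r = v x 0 by rewrite /a mulrAC -mulrA mp_mulV ?mulr1.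
have a1 : (a <= 1)%O.
  by rewrite -(mp_lepM2l _ _ r0) mulr1 mulrC ar.
have al t : (a * t <= t)%O by rewrite -[X in (_ <= X)%O]mul1r mp_leM.
have yN : y \notin i :: p.
  move: luniq; rewrite lp -cat_cons cat_uniq => /and3P[_ + _].
  by rewrite /= negb_or => /andP[].
pose u := restrict v (i :: p) + a *: w.
(* Needed on the whole path because the closing arc may lead back into the prefix. *)
have wu k : k \in i :: l -> (a * v k 0%R <= u k 0%R)%O.
  rewrite lp -cat_cons mem_cat /u mxE [X in _ + X]mxE restrictE => /orP[->|kq].
    exact: le_trans (al _) (mp_ler_add _ _).
  by rewrite /w restrictE kq mp_ler_addr.
have uv : u = v.
  apply: vm.
  - apply: graft_supereig => //.
      rewrite -xp -ar -row_prodZ; apply: row_prod_mono => k.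
      by rewrite [X in (_ <= X)%O]mxE mp_ler_addr.
    move=> j; rewrite mxE restrictE; case: ifP => [jq|_]; last first.
      by rewrite mulr0 mp_ge0.
    have [k kl /andP[_ jk]] : exists2 k, k \in i :: l & adm v j k.
      move: jq; rewrite {1}lastI mem_rcons inE => /predU1P[->|].
        by exists z => //; move: lz; rewrite lp last_cat.
      move=> /(path_succ yq)[k kq]; exists k => //.
      by rewrite lp inE mem_cat inE kq !orbT.
    apply: le_trans (mp_leM2l _ jk) (le_trans _ (le_row_prod _ k _)).
    by rewrite mulrCA; apply: mp_leM2l; apply: wu.
  - move=> j; rewrite mxE mp_add_le restrict_le mxE /=.
    exact: le_trans (al _) (restrict_le _ _ _).
  - apply: le_anti; rewrite mxE restrictE mem_head mp_ler_add andbT mp_add_le lexx mxE /=.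
    exact: le_trans (al _) (restrict_le _ _ _).
(* At [y], which is not in the prefix, the real entry of [v] is unchanged by the scaling, so [a] is
   1. *)
have : u y 0 = v y 0 by rewrite uv.
rewrite /u mxE [X in _ + X]mxE /w !restrictE (negbTE yN) mem_head add0r => ay.
have a1' : a = 1.
  rewrite -[a]mulr1 -(mp_mulV (adm_neq0 xy)) mulrA ay mp_mulV //.
  exact: adm_neq0 xy.
by rewrite -/w -/r -ar a1' mul1r.
Qed.

Lemma minimal_tight s (x y : 'I_n) q : i :: l = s ++ x :: y :: q ->
  A x y * v y 0 = v x 0.
Proof.
move=> e; have [p _ [_ _ _ /andP[_ xy] _]] := split_path e.
apply: le_anti; rewrite xy andbT -(minimal_suffix_eq e).
by apply: le_trans (le_row_prod _ y _); rewrite restrictE mem_head.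
Qed.

(** A smaller competitor with the same entry at [y] can be grafted onto the prefix, and minimality
    of [v] then forces it to agree with the suffix. Having [z] in the suffix keeps the closing arc
    inside it. *)
Lemma minimal_suffix s (y : 'I_n) q : i :: l = s ++ y :: q -> z \in y :: q ->
  minimal_at y (restrict v (y :: q)).
Proof.
case/lastP: s => [|s x] e zq; first by case: e => <- <-; rewrite restrict_all.
rewrite cat_rcons in e.
have [p _ [xp lp pp xy yq]] := split_path e.
have [_ vi vm] := vmin.
split.
- rewrite -[restrict _ _]addr0; apply: graft_supereig => // [|j].
    rewrite addr0; move: lz; rewrite lp last_cat /= => /andP[_ h].
    apply: le_trans h (le_trans _ (le_row_prod _ z _)).
    by rewrite restrictE zq.
  by rewrite mxE mp_ge0.
- by rewrite restrictE mem_head (adm_neq0 xy).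
move=> x' x'X x'le; rewrite restrictE mem_head => x'y.
have uv : restrict v (i :: p) + x' = v.
  apply: vm.
  - apply: graft_supereig => //; last first.
      move=> j; apply: le_trans ((supereigP x').1 x'X j) _.
      by apply: row_prod_mono => k; rewrite mxE mp_ler_addr.
    rewrite -xp; case/andP: xy => _ vxy.
    apply: le_trans vxy (le_trans _ (le_row_prod _ y _)).
    by rewrite -x'y mxE; apply: mp_leM2l; apply: mp_ler_addr.
  - move=> j; rewrite mxE mp_add_le restrict_le /=.
    exact: le_trans (x'le j) (restrict_le _ _ _).
  - apply: le_anti; rewrite mxE restrictE mem_head mp_ler_add andbT mp_add_le lexx /=.
    exact: le_trans (x'le i) (restrict_le _ _ _).
apply: vle_anti => // j; rewrite restrictE; case: ifP => [jq|_]; last exact: mp_ge0.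
rewrite -uv mxE restrictE ifF ?add0r //.
apply/negbTE; move: luniq; rewrite lp -cat_cons cat_uniq => /and3P[_ + _].
by apply: contra => jp; apply/hasP; exists j.
Qed.

End MinimalPath.

(** * Norm and normalization *)

Lemma vnormZ a v : vnorm (a *: v) = a * vnorm v.
Proof. by rewrite /vnorm mulr_sumr; apply: eq_bigr => j _; rewrite mxE. Qed.

Lemma vnorm_eq0 v : vnorm v = 0 -> v = 0.
Proof.
move=> v0; apply/matrixP => j k; rewrite ord1 mxE; apply/eqP.
rewrite -mp_le0 -v0; exact: (mp_le_sum (fun j => v j 0) (mem_index_enum j)).
Qed.

Lemma normalize_scaled v : v != 0 -> scaled (normalize v).
Proof.
move=> v0; rewrite /scaled /normalize vnormZ mulrC mp_mulV //.
by apply: contraNneq v0 => /vnorm_eq0 ->.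
Qed.

Lemma normalizeZ a v : a != 0 -> normalize (a *: v) = normalize v.
Proof.
move=> a0; rewrite /normalize vnormZ mp_invM scalerA mulrC mulrA mp_mulV //.
by rewrite mul1r.
Qed.

(** * Runs of the algorithm that rebuild a given vector *)

Lemma step1_loop_tight v (z : 'I_n) q1 q2 :
  (forall p (y : 'I_n) q, q1 ++ q2 = p ++ y :: q ->
     (row_prod A (last z p) (restrict v (z :: p)) < v (last z p) 0%R)%O /\
     A (last z p) y * v y 0 = v (last z p) 0) ->
  step1_loop A (mp_inv (v (last z q1) 0) *: restrict v (z :: q1)) (last z q1) q2
  = mp_inv (v (last z (q1 ++ q2)) 0) *: restrict v (z :: q1 ++ q2).
Proof.
(* Loop invariant: the current vector is [v] restricted to the visited nodes, shifted so that the
   newest entry is 0. The strict inequality prevents stopping. *)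
elim: q2 q1 => [|y q IH] q1 H /=; first by rewrite cats0.
have [lt1 eq1] := H q1 y q erefl.
have vx0 : v (last z q1) 0 != 0.
  by apply: contraTneq lt1 => ->; rewrite -leNgt mp_ge0.
have := vx0; rewrite -{1}eq1 mp_mul_neq0 => /andP[axy vy0].
rewrite ifF; last first.
  apply/negbTE/negP => /set_mem; rewrite /supereig_row /= row_prodZ !mxE mem_last.
  by rewrite mp_lepM2l ?mp_inv_neq0 // leNgt lt1.
have -> : unit_vec R y + row_prod A (last z q1) (unit_vec R y) *:
    (mp_inv (v (last z q1) 0) *: restrict v (z :: q1)) =
    mp_inv (v (last z (rcons q1 y)) 0) *: restrict v (z :: rcons q1 y).
  (* Since [A x y] is $v_x-v_y$ for the current node $x$, multiplying by it moves the normalization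
     from $x$ to [y]. *)
  rewrite row_prod_unit_vec scalerA -[X in mp_inv X]eq1 mp_invM mulrA mp_mulV //.
  rewrite mul1r -rcons_cons restrict_rcons last_rcons scalerDr scalerA.
  by rewrite [_ * v y 0]mulrC mp_mulV // scale1r addrC.
have := IH (rcons q1 y); rewrite last_rcons cat_rcons; exact.
Qed.

(** The three conditions at [x] say that the loop test does not stop, that the rebuilt entry is that
    of [v], and that the extremality test passes. [rest] allows the run to go on beyond [p]; [p] is
    nonempty since the starting vector is not returned. *)
Lemma step2_loop_mem v a s p rest : a != 0 -> p != [::] ->
  (forall p1 (x : 'I_n) p2, p = p1 ++ x :: p2 ->
    [/\ (A x x * v x 0%R < v x 0%R)%O,
        row_prod A x (restrict v (p2 ++ s)) = v x 0 &
        extremal A (restrict v (x :: p2 ++ s))]) ->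
  normalize (restrict v (p ++ s)) \in
    step2_loop A (a *: restrict v s) (rev p ++ rest).
Proof.
move=> a0; elim/last_ind: p s => [//|p x IH] s _ H.
have [] := H p x [::]; rewrite ?cats1 //= => lt1 eq1 ext1.
rewrite rev_rcons cat_rcons /= ifF; last first.
  apply/negbTE/negP => /set_mem; rewrite /supereig_row /= row_prod_unit_vec.
  rewrite unit_vecE eqxx => h.
  by move: lt1; rewrite ltNge -{1}[v x 0]mul1r ![_ * v x 0]mulrC mp_leM2l.
rewrite row_prodZ eq1 -scalerA -scalerDr -restrict_cons asboolT; last exact: extremalZ.
case: (eqVneq p [::]) => [-> /=|p0].
  by rewrite normalizeZ // mem_head.
rewrite inE; apply/orP; right; apply: IH => // p1 y p2 ep.
by have [] := H p1 y (rcons p2 x); rewrite ?ep ?rcons_cat // cat_rcons.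
Qed.

Lemma maximum_path_extend s i p : path (Defs.arc A) i p -> uniq (i :: p) ->
  (forall j, j \in i :: p -> (j \in s) = (j == last i p)) ->
  exists r k p', k :: p' = r ++ i :: p /\ maximum_path A s k p'.
Proof.
have [m] : exists m, (n <= size p + m)%N by exists n; rewrite leq_addl.
elim: m i p => [|m IH] i p.
  rewrite addn0 => + _ /card_uniqP ci.
  have := max_card (mem (i :: p)); rewrite ci card_ord /= => h1 h2.
  by move: (leq_trans h1 h2); rewrite ltnn.
move=> sp pp up hs.
have [/existsP[j /and3P[js jp aji]]|nj] :=
    boolP [exists j, [&& j \notin s, j \notin i :: p & Defs.arc A j i]].
  have [||||r [k [p' [e kp]]]] := IH j (i :: p).
  - by rewrite /= addSnnS.
  - by rewrite /= aji.
  - by rewrite cons_uniq jp.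
  - move=> k; rewrite inE /= => /predU1P[->|/hs //].
    by rewrite (negbTE js); apply/esym; apply: contraNF jp => /eqP ->; apply: mem_last.
  by exists (rcons r j), k, p'; rewrite cat_rcons.
exists [::], i, p; split => //; split => // j js jp.
by apply: contra nj => aji; apply/existsP; exists j; rewrite js jp.
Qed.

Lemma adm_path_weight v i s : path (adm v) i s ->
  (v i 0%R <= (Some (path_weight A i s) : maxplus R) * v (last i s) 0%R)%O.
Proof.
elim: s i => [|j s IH] i /=; first by rewrite mul1r.
case/andP=> /[dup] /adm_arc aij /andP[_ ij] /IH js.
apply: le_trans ij (le_trans (mp_leM2l _ js) _); rewrite mulrA.
suff -> : A i j * Some (path_weight A j s) =
    Some (arc_weight A i j + path_weight A j s) :> maxplus R by [].
by move: aij; rewrite /Defs.arc /arc_weight; case: (A i j).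
Qed.

(** Chaining the inequalities around the cycle gives $v_z\le\omega+v_z$, and the real $v_z$
    cancels. *)
Lemma adm_cycle_nonneg v z q : path (adm v) z q -> adm v (last z q) z ->
  uniq (z :: q) -> nonneg_elem_cycle A (z :: q).
Proof.
move=> pq qz uq.
have pz : path (adm v) z (rcons q z) by rewrite rcons_path pq.
split => //.
  by split => //=; apply: sub_path pz => a b; apply: adm_arc.
have := adm_path_weight pz; rewrite last_rcons /=.
have := adm_neq0 qz; case: (v z 0) => [c|//] _.
by rewrite {1}/Order.le /= -{1}[c]add0r lerD2r.
Qed.

Lemma extremal_in_output v : extremal A v -> algorithm_output A (normalize v).
Proof.
case/extremal_minimal_at=> i vmin; have [vX vi _] := vmin.
have [l [lpath luniq [z zl lz]]] := adm_path_closing vX vi.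
(* [p] is the tail and [z :: q] the cycle. *)
have [p [q lpq]] : exists p q, i :: l = p ++ z :: q.
  by case/splitPr: {lz} zl => p q; exists p, q.
have lastq : last i l = last z q.
  by have := congr1 (last z) lpq; rewrite last_cat.
have uq : uniq (z :: q) by move: luniq; rewrite lpq cat_uniq => /and3P[].
have cyc_vec : cycle_vec A (z :: q) z =
    mp_inv (v (last z q) 0) *: restrict v (z :: q).
  rewrite /cycle_vec /= eqxx rot0 /=.
  have vz : v z 0 != 0 by case: (adm_neq0 lz).
  have -> : unit_vec R z = mp_inv (v z 0) *: restrict v [:: z].
    rewrite -[[:: z]]/(rcons [::] z) restrict_rcons scalerDr scalerA.
    rewrite [_ * v z 0]mulrC mp_mulV // scale1r.
    suff -> : restrict v [::] = 0 by rewrite scaler0 add0r.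
    by apply/matrixP => j k; rewrite !mxE.
  apply: (step1_loop_tight (q1 := [::])) => p' y q' /= eq'.
  have el : i :: l = (p ++ belast z p') ++ last z p' :: y :: q'.
    by rewrite lpq eq' cat_belast_last catA.
  split; last exact: (minimal_tight vmin lpath luniq zl lz el).
  (* The algorithm tests row [last z p'] on visited cycle nodes only; they lie in the prefix of the
     path, where the strict inequality is known. *)
  apply: le_lt_trans (minimal_prefix_lt vmin lpath luniq el).
  apply: row_prod_mono; apply: restrict_subset => j.
  by rewrite rcons_cat -lastI mem_cat orbC => ->.
have vb : mp_inv (v (last z q) 0) != 0.
  by rewrite mp_inv_neq0 -lastq; case/andP: lz.
have suffix_ext s (x : 'I_n) t : i :: l = s ++ x :: t -> z \in x :: t ->
    extremal A (restrict v (x :: t)).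
  move=> e zt; apply: minimal_at_extremal.
  exact: (minimal_suffix vmin lpath luniq zl lz e).
have cext : extremal A (cycle_vec A (z :: q) z).
  by rewrite cyc_vec; apply: extremalZ => //; apply: suffix_ext lpq (mem_head _ _).
exists (z :: q).
  apply: (@adm_cycle_nonneg v) => //; last by rewrite -lastq.
  case: p lpq {suffix_ext} => [|j p] [ei el]; first by rewrite -el -ei.
  by move: lpath; rewrite el cat_path /= => /and3P[].
have vall : restrict v (i :: l) = v := restrict_all vmin lpath luniq zl lz.
(* Without a tail, step 1 yields [v] up to scaling; otherwise step 2 does. *)
case: p lpq => [|i' p] lpq; [left|right].
  exists z; first by split; rewrite ?mem_head.
  by rewrite cyc_vec normalizeZ // -[in RHS]vall lpq.
case: lpq => _ el.
have eiz : i :: l = (i :: rcons p z) ++ q by rewrite el /= cat_rcons.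
have [|||r [k [p' [ek kmax]]]] := @maximum_path_extend (z :: q) i (rcons p z).
- move: lpath; rewrite el -cat_rcons cat_path => /andP[+ _].
  by apply: sub_path => a b; apply: adm_arc.
- by move: luniq; rewrite eiz cat_uniq => /andP[].
- move=> j jp; rewrite last_rcons inE; case: eqP => //= jz.
  apply/negbTE/negP => jq; move: luniq; rewrite eiz cat_uniq => /and3P[_ /hasP[]].
  by exists j.
have lastk : last k p' = z.
  by have := congr1 (last z) ek; rewrite /= last_cat /= last_rcons.
exists k, p'; rewrite lastk; split => //.
(* [behead] drops [z] from the reversed path; the tail of [v] is then processed before the added
   nodes [r]. *)
rewrite ek -[i :: rcons p z]/(rcons (i :: p) z) -rcons_cat rev_rcons rev_cat /=.
rewrite cyc_vec -{1}vall el -cat_cons.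
apply: step2_loop_mem => // p1 x p2 ep.
have e1 : i :: l = p1 ++ x :: (p2 ++ z :: q).
  by rewrite el -cat_cons ep -catA.
have [y [q' e2]] : exists (y : 'I_n) q', p2 ++ z :: q = y :: q'.
  by case: (p2) => [|y p3]; [exists z, q | exists y, (p3 ++ z :: q)].
have e3 := e1; rewrite e2 in e3; split.
(* The loop term [A x x * v x 0] occurs in row [x] on the prefix ending at [x]. *)
- apply: le_lt_trans (minimal_prefix_lt vmin lpath luniq e3).
  apply: le_trans (le_row_prod _ x _).
  by rewrite restrictE mem_rcons mem_head.
- by rewrite e2; apply: (minimal_suffix_eq vmin lpath luniq zl lz e3).
- apply: suffix_ext e1 _.
  by rewrite inE mem_cat mem_head !orbT.
Qed.

(** * Every output is a normalized extremal *)

Lemma step2_loop_extremal v rest w : w \in step2_loop A v rest ->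
  exists2 u, extremal A u & w = normalize u.
Proof.
elim: rest v => [//|j rest IH] v /=; case: ifP => // _.
case: asboolP => // ext; rewrite inE => /predU1P[->|/IH //].
by exists (v + row_prod A j v *: unit_vec R j).
Qed.

Lemma algorithm_outputE w :
  algorithm_output A w <-> exists2 u, extremal A u & w = normalize u.
Proof.
split=> [[s _ [[j [_ ext] <-]|[k [p [_ _ /step2_loop_extremal //]]]]]|[u ext ->]].
  by exists (cycle_vec A s j).
exact: extremal_in_output.
Qed.

Lemma normalize_extremal v : extremal A v -> extremal A (normalize v).
Proof.
move=> ext; apply: extremalZ => //; rewrite mp_inv_neq0.
by case: ext => _ v0 _; apply: contraNneq v0 => /vnorm_eq0 ->.
Qed.

Lemma normalizeK v : v != 0 -> vnorm v *: normalize v = v.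
Proof.
move=> v0; rewrite /normalize scalerA mp_mulV ?scale1r //.
by apply: contraNneq v0 => /vnorm_eq0 ->.
Qed.

(** * Spans, independence and generation *)

Lemma supereig_max_span S : S `<=` supereig A -> max_span S `<=` supereig A.
Proof.
move=> SX _ [alpha [_ ->]]; case: finite_supportP => [_|X XS _ _].
  by rewrite big_nil; apply: supereig0.
rewrite big_seq; apply: supereig_sum => x xX; apply: supereigZ.
exact/SX/XS.
Qed.

Lemma max_span_fin_sum S (T : finType) (c : T -> maxplus R)
    (g : T -> 'cV[maxplus R]_n) : (forall t, S (g t)) ->
  max_span S (\sum_t c t *: g t).
Proof.
move=> Sg; pose r := undup (codom g).
pose alpha x := \sum_(t | g t == x) c t.
have alpha0 x : x \notin r -> alpha x = 0.
  rewrite mem_undup => xr; apply: big1 => t /eqP gt.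
  by rewrite -gt codom_f in xr.
exists alpha; split.
  apply: (sub_finite_set (B := [set` r])); last exact: finite_seq.
  by move=> x [_ /=]; apply: contraNT => /alpha0 ->.
rewrite (fsbigE r); first last.
- by move=> x _ /alpha0 ->; rewrite scale0r.
- by move=> x; rewrite /= mem_undup => /codomP[t ->].
- exact: undup_uniq.
rewrite [RHS]big_mkcond [RHS](eq_big_seq (fun x => \sum_(t | g t == x) c t *: g t)).
  rewrite (exchange_big_dep xpredT) //=; apply: eq_bigr => t _.
  rewrite (big_rem (g t)) /=; last by rewrite mem_undup codom_f.
  rewrite eqxx big_seq_cond big1 ?addr0 // => x /andP[+ /eqP xg].
  by rewrite -xg mem_rem_uniq ?undup_uniq // inE eqxx.
move=> x; rewrite mem_undup => /codomP[t0 xt0].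
rewrite ifT; last by apply: mem_set; rewrite xt0.
by rewrite scaler_suml; apply: eq_bigr => t /eqP ->.
Qed.

Lemma scaled_extremal_independent S :
  (forall v, S v -> scaled v /\ extremal A v) -> independent S.
Proof.
move=> SE v /SE[v1 vext] [alpha [_]].
case: finite_supportP => [_|X XS _ _] vsum.
  by case: vext => _ + _; rewrite vsum big_nil eqxx.
have [|x xX vx] := extremal_sum vext _ vsum.
  by move=> x /XS[/SE[_ [xX _ _]] _]; apply: supereigZ.
have [/SE[x1 _] xv] := XS x xX.
apply: xv => /=; rewrite vx; move: v1; rewrite /scaled vx vnormZ x1 mulr1 => ->.
by rewrite scale1r.
Qed.

Lemma max_span_extremals S : (forall v, extremal A v -> S (normalize v)) ->
  supereig A `<=` max_span S.
Proof.
move=> SE v vX.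
pose T := {i : 'I_n | v i 0 != 0}.
have gP (t : T) : exists u, [/\ extremal A u, vle u v & u (val t) 0 = v (val t) 0].
  have [u [umin uv ut]] := minimal_at_below vX (valP t).
  by exists u; split => //; apply: minimal_at_extremal umin.
have [g {}gP] := choice gP.
suff -> : v = \sum_t vnorm (g t) *: normalize (g t).
  by apply: max_span_fin_sum => t; apply: SE; case: (gP t).
rewrite (eq_bigr g); last by move=> t _; apply: normalizeK; case: (gP t) => -[].
apply: vle_anti => j; rewrite summxE; last first.
  by apply: mp_sum_le => t _; case: (gP t).
have [->|vj] := eqVneq (v j 0) 0; first exact: mp_ge0.
case: (gP (Sub j vj)) => _ _; rewrite SubK => <-.
exact: (mp_le_sum (fun t => g t j 0) (mem_index_enum _)).
Qed.

End Cone.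

Theorem theorem3p1 (R : realType) (n : nat) (A : 'M[maxplus R]_n)
    (hA : (0 <= max_cycle_mean A)%E) :
  (forall v, algorithm_output A v -> scaled v) /\
  is_basis (algorithm_output A) (supereig A).
Proof.
have outE v : algorithm_output A v -> scaled v /\ extremal A v.
  case/algorithm_outputE => u uext ->; split; last exact: normalize_extremal.
  by apply: normalize_scaled; case: uext.
split; first by move=> v /outE[].
split; first exact: scaled_extremal_independent outE.
apply/seteqP; split.
  by apply: supereig_max_span => v /outE[_ []].
by apply: max_span_extremals; apply: extremal_in_output.
Qed.
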